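(* The dissipative outer billiard about any quadrilateral sufficiently close to the square with contraction rates sufficiently close to some real in $(0,1)\setminus\Lambda$ is asymptotically periodic. That is: for every $\mu\in(0,1)\setminus\Lambda$ there exists $\delta>0$ such that if $P'$ is a convex quadrilateral whose vertices, in counterclockwise order, are within $\delta$ of the corresponding vertices $0,-i,1-i,1$ of the unit square, and $\boldsymbol{\lambda}'=(\lambda_1',\ldots,\lambda_4')\in(0,1)^4$ satisfies $|\lambda_j'-\mu|<\delta$ for $j=1,\ldots,4$, then the map $T_{P',\boldsymbol{\lambda}'}$ is asymptotically periodic.
   Context: Let $P\subset\mathbb{C}$ be a (closed) convex $k$-gon with vertices $w_1,\ldots,w_k$ in counterclockwise order (indices mod $k$) and $\boldsymbol{\lambda}=(\lambda_1,\ldots,\lambda_k)\in(0,1)^k$. Let $X=\mathbb{C}\setminus P$ and $A_j=\{w_j+x(w_{j-1}-w_j)+y(w_j-w_{j+1}) : x,y>0\}$; these are disjoint open cones in $X$. The dissipative outer billiard map is $T_{P,\boldsymbol{\lambda}}(z)=-\lambda_jz+(1+\lambda_j)w_j$ for $z\in A_j$; it is not defined on the singular set $\mathcal{S}=X\setminus\bigcup_jA_j$. A point $z\in X$ is non-singular if its forward orbit never meets $\mathcal{S}$. $\omega(T_{P,\boldsymbol{\lambda}})$ denotes the union of the $\omega$-limit sets of all non-singular points. $T_{P,\boldsymbol{\lambda}}$ is asymptotically periodic if $\omega(T_{P,\boldsymbol{\lambda}})$ is the union of finitely many periodic orbits and the forward orbit of every non-singular point converges to one of them. $\Lambda=\{\lambda_1,\lambda_2,\ldots\}$,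 where in this set $\lambda_n$ ($n\ge1$) denotes the unique root in $[0,1)$ of $x^{2n}-x^n-x^{n-1}+1$. *)

(* Defs.v *)
From HB Require Import structures.
From mathcomp Require Import all_boot all_order all_algebra complex.
From mathcomp Require Import boolp classical_sets functions cardinality reals.
From mathcomp Require Import topology normedtype sequences.

Set Implicit Arguments.
Unset Strict Implicit.
Unset Printing Implicit Defensive.

Import Order.TTheory GRing.Theory Num.Theory.
Import numFieldNormedType.Exports.

Local Open Scope classical_set_scope.
Local Open Scope complex_scope.
Local Open Scope ring_scope.

Section Polygons.
Variables (R : realType) (k : nat).
Implicit Types (w : 'I_k -> R[i]) (j : 'I_k).

(* positive iff b points strictly to the left of a *)
Definition cross (a b : R[i]) : R :=
  complex.Re a * complex.Im b - complex.Im a * complex.Re b.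

(* The w_j, in this order, are the vertices of a convex k-gon traversed
   counterclockwise: every other vertex lies strictly to the left of each
   oriented edge line from w_j to w_(j+1). Indices are cyclic via ordS. *)
Definition ccw_convex_polygon w : Prop :=
  (2 < k)%N /\
  forall i j, i != j -> i != ordS j -> 0 < cross (w (ordS j) - w j) (w i - w j).

Definition polygon w : set R[i] :=
  [set z | exists c : 'I_k -> R,
    [/\ forall j, 0 <= c j, \sum_j c j = 1 & z = \sum_j (c j)%:C * w j]].

Definition table w : set R[i] := ~` polygon w.

Definition cone w j : set R[i] :=
  [set z | exists x y : R, [/\ 0 < x, 0 < y &
    z = w j + x%:C * (w (ord_pred j) - w j) + y%:C * (w j - w (ordS j))]].

Definition singular_set w : set R[i] :=
  table w `\` \bigcup_(j in [set: 'I_k]) cone w j.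

End Polygons.

Section Billiard.
Variables (R : realType) (k : nat) (w : 'I_k -> R[i]) (lam : 'I_k -> R).
Implicit Types (z p : R[i]) (O : set R[i]).

(* The value z off the cones is junk: every notion below only iterates the map
   along orbits of non-singular points, which stay in the cones. For a convex
   polygon the cones are disjoint, so the index picked is the only one. *)
Definition billiard_map z : R[i] :=
  if [pick j | z \in cone w j] is Some j
  then - (lam j)%:C * z + (1 + lam j)%:C * w j
  else z.

Definition nonsingular z : Prop :=
  table w z /\ forall n, ~ singular_set w (iter n billiard_map z).

Definition forward_orbit z : set R[i] :=
  [set iter n billiard_map z | n in [set: nat]].

(* R[i] gets its topology through its numFieldType structure *)
Definition omega_limit z : set R[i] :=
  cluster ((fun n => iter n billiard_map z : (R[i] : numFieldType)) @ \oo).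

Definition omega : set R[i] := \bigcup_(z in nonsingular) omega_limit z.

Definition periodic_orbit O : Prop :=
  exists p n, [/\ nonsingular p, (0 < n)%N, iter n billiard_map p = p
                & O = forward_orbit p].

Definition orbit_converges_to z O : Prop :=
  forall e : R, 0 < e ->
    \forall n \near \oo, exists2 p, O p & `|iter n billiard_map z - p| < e%:C.

Definition asymptotically_periodic : Prop :=
  exists Os : set (set R[i]),
    [/\ finite_set Os,
        forall O, Os O -> periodic_orbit O,
        omega = \bigcup_(O in Os) O
      & forall z, nonsingular z -> exists2 O, Os O & orbit_converges_to z O].

End Billiard.

Definition square (R : realType) : 'I_4 -> R[i] :=
  tnth [tuple 0; (- 'i)%C; (1 - 'i)%C; 1].

Definition Lambda (R : realType) : set R :=
  [set x | exists2 n, (0 < n)%N &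
    unique (fun y => 0 <= y < 1 /\ y ^+ (2 * n) - y ^+ n - y ^+ n.-1 + 1 = 0) x].

(* Main.v *)
Require Import Defs.
From HB Require Import structures.
From mathcomp Require Import all_boot all_order all_algebra complex.
From mathcomp Require Import boolp classical_sets functions cardinality reals.
From mathcomp Require Import topology normedtype sequences.
From mathcomp Require Import ring lra zify.

Set Implicit Arguments.
Unset Strict Implicit.
Unset Printing Implicit Defensive.

Import Order.TTheory GRing.Theory Num.Theory.
Import numFieldNormedType.Exports.

Local Open Scope classical_set_scope.
Local Open Scope complex_scope.
Local Open Scope ring_scope.

(** For the edge from w_j to w_(j+1), let E_j be the affine functional that is
positive on the side of the polygon. The cone at w_j is the set where E_j > 0
and E_(j-1) < 0 ([cone_edge]). For the unit square, E_j + E_(j+2) = 1, and with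
all rates equal to mu the coordinates a = E_j and b = - E_(j-1) of a point of
the j-th cone evolve independently of j: the point either turns,
(a, b) |-> (1 - mu b, mu a), into the next cone, or jumps,
(a, b) |-> (1 + mu a, mu b - 1), into the opposite one, according to the sign
of 1 - mu b.

An orbit is thus a sequence of blocks, a block of length n being n - 1 jumps
followed by a turn. At the end of such a block b is at most
mu + ... + mu^n, whereas n jumps in a row require
b > mu^-1 + ... + mu^-n. Hence the lengths of the blocks never increase
([block_next]), and they are eventually constant. The affine map that describes
one block of length n contracts to a fixed point (a0, b0), where 1 - a0 is
- mu g_n / ((1 - mu) (1 + mu^(2 n))) and g_n is the value at mu of the n-th
polynomial defining Lambda. Orbits that repeat this block force a0 <= 1, and
the fixed point meets the singular set only if a0 = 1, that is, only if g_n
vanishes. Each of these polynomials has at most one root in (0, 1), so that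
mu lies outside Lambda precisely when no g_n vanishes ([bifurcation_neq0]).

All these inequalities are strict with room to spare, so they survive a small
error in every step: this is [pseudo_orbit_eventually_periodic], about
sequences that follow the two branches up to an error eps. An orbit of a
billiard near the square enters a fixed box, and from then on it is such a
sequence ([step_near_square]). So its itinerary is eventually that of one of
finitely many constant blocks, and it stays at a positive distance from the
singular set ([eventually_itinerary]). The composition of the reflections along
one period of the itinerary is a homothety of ratio less than 1 in absolute
value. Its fixed point inherits the distance from the singular set from the
orbit that it attracts; it is therefore a genuine periodic point of the
billiard ([limit_cone], [limit_map]), and it is determined by the block length
and the initial cone, which leaves finitely many periodic orbits. *)

(** * Contracting recursions and geometric sums *)

Section Geometric.
Variable R : realType.
Implicit Types (x y r c e mu : R) (n m : nat).

Lemma geometric_small r e : 0 <= r < 1 -> 0 < e ->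
  exists k, forall i, (k <= i)%N -> r ^+ i <= e.
Proof.
move=> /andP[r0 r1] e0.
have /cvgrPdist_le/(_ e e0)[k _ H] : (fun i => r ^+ i) @ \oo --> (0 : R).
  by apply: cvg_expr; rewrite ger0_norm.
exists k => i ki; have := H i ki; rewrite /= sub0r normrN.
exact/le_trans/ler_norm.
Qed.

Lemma contraction_eventually r c e (x : nat -> R) : 0 <= r < 1 -> 0 < e ->
  (forall i, x i.+1 <= r * x i + c) ->
  exists k, forall i, (k <= i)%N -> x i <= c / (1 - r) + e.
Proof.
move=> r01 e0 Hx; have /andP[r0 r1] := r01.
have bnd i : x i <= r ^+ i * `|x 0%N - c / (1 - r)| + c / (1 - r).
  elim: i => [|i IH]; first by rewrite expr0 mul1r -lerBlDr ler_norm.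
  apply: (le_trans (Hx i)).
  have -> : r ^+ i.+1 * `|x 0%N - c / (1 - r)| + c / (1 - r) =
    r * (r ^+ i * `|x 0%N - c / (1 - r)| + c / (1 - r)) + c.
    rewrite exprS; field; lra.
  by rewrite lerD2r ler_wpM2l.
set D := `|_| in bnd; have D0 : 0 <= D by apply: normr_ge0.
have eD0 : 0 < e / (D + 1) by rewrite divr_gt0 // ltr_wpDl.
have [k Hk] := geometric_small r01 eD0.
exists k => i /Hk Hi; apply: (le_trans (bnd i)); rewrite addrC lerD2l.
have : r ^+ i * (D + 1) <= e by rewrite -ler_pdivlMr //; lra.
have : 0 <= r ^+ i by rewrite exprn_ge0.
nra.
Qed.

Definition geosum mu n : R := \sum_(i < n) mu ^+ i.

Lemma geosum0 mu : geosum mu 0 = 0. Proof. by rewrite /geosum big_ord0. Qed.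

Lemma geosumS mu n : geosum mu n.+1 = 1 + mu * geosum mu n.
Proof.
rewrite /geosum big_ord_recl expr0 mulr_sumr; congr (_ + _).
by apply: eq_bigr => i _; rewrite exprS.
Qed.

Lemma geosum_ge0 mu n : 0 <= mu -> 0 <= geosum mu n.
Proof. by move=> mu0; apply: sumr_ge0 => i _; rewrite exprn_ge0. Qed.

Lemma geosum_closed mu n : (1 - mu) * geosum mu n = 1 - mu ^+ n.
Proof.
elim: n => [|n IH]; first by rewrite geosum0 expr0; ring.
by rewrite geosumS exprS mulrDr mulrCA IH; ring.
Qed.

End Geometric.

(** * The polynomials that define Lambda *)

Section BifurcationPolynomial.
Variable R : realType.
Implicit Types (x y mu : R) (n : nat).

Definition bifurcation n x : R := x ^+ (2 * n) - x ^+ n - x ^+ n.-1 + 1.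

(** For 0 < x < 1 only the second factor can vanish. Divided by x^(n+1), it is
    a sum of n negative powers of x minus a sum of nonnegative powers. So it is
    - 1 for n = 0 and decreasing for n > 0, hence has at most one root. *)
Lemma bifurcation_factor n x :
  bifurcation n.+1 x = (1 - x) * (geosum x n - x ^+ n.+1 * geosum x n.+1).
Proof.
have e1 := geosum_closed x n; have e2 := geosum_closed x n.+1.
have -> : (1 - x) * (geosum x n - x ^+ n.+1 * geosum x n.+1) =
  (1 - x) * geosum x n - x ^+ n.+1 * ((1 - x) * geosum x n.+1) by ring.
by rewrite e1 e2 /bifurcation /= mul2n -addnn exprD; ring.
Qed.

Lemma geosum_le x y n : 0 <= x <= y -> geosum x n <= geosum y n.
Proof.
move=> /andP[x0 xy]; apply: ler_sum => i _.
by apply: lerXn2r => //; rewrite nnegrE //; apply: le_trans xy.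
Qed.

(** Divided by (x * y)^m, both sides are sums of powers of exponent at most 0. *)
Lemma geosum_expr_le x y n m : 0 <= x <= y -> (n <= m)%N ->
  geosum y n * x ^+ m <= geosum x n * y ^+ m.
Proof.
move=> /andP[x0 xy] nm; have y0 := le_trans x0 xy.
rewrite /geosum !mulr_suml; apply: ler_sum => i _.
have im : (i <= m)%N by apply: leq_trans nm; apply: ltnW.
rewrite -(subnKC im) !exprD mulrCA ler_wpM2l ?exprn_ge0 //.
apply: ler_wpM2l; first exact: exprn_ge0.
by apply: lerXn2r; rewrite ?nnegrE.
Qed.

Lemma bifurcation_root_lt x y n :
  0 < x -> x < y -> y < 1 ->
  bifurcation n.+1 x = 0 -> bifurcation n.+1 y = 0 -> False.
Proof.
move=> x0 xy y1; have x1 := lt_trans xy y1; have y0 := lt_trans x0 xy.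
have red z : z < 1 -> bifurcation n.+1 z = 0 ->
    geosum z n = z ^+ n.+1 * geosum z n.+1.
  move=> z1 /eqP; rewrite bifurcation_factor mulf_eq0 !subr_eq0 => /orP[|/eqP//].
  by rewrite gt_eqF.
move=> /(red _ x1) ex /(red _ y1) ey.
have xy' : 0 <= x <= y by rewrite !ltW.
have := geosum_expr_le xy' (leqnSn n).
rewrite ex ey -mulrA [leRHS]mulrAC -[leRHS]mulrA mulrC [leRHS]mulrC -!mulrA.
case: n {red} ex ey => [|n] ex ey.
  move: ex; rewrite geosum0 geosumS geosum0 mulr0 addr0 mulr1 expr1; lra.
move=> H.
have H1 : geosum y n.+2 <= geosum x n.+2.
  have p : 0 < x ^+ n.+2 * y ^+ n.+2 by rewrite mulr_gt0 ?exprn_gt0.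
  by rewrite -(ler_pM2l p); nra.
suff : geosum x n.+2 < geosum y n.+2 by rewrite ltNge H1.
rewrite geosumS [ltRHS]geosumS ltrD2l.
have g1 := geosum_le n.+1 xy'.
have g2 : 0 < geosum x n.+1 by rewrite geosumS; have := geosum_ge0 n (ltW x0); nra.
nra.
Qed.

Lemma bifurcation_neq0 mu n : 0 < mu < 1 -> ~ @Lambda R mu -> (0 < n)%N ->
  bifurcation n mu != 0.
Proof.
move=> /andP[mu0 mu1] muL n0; apply/eqP => g0; apply: muL.
exists n => //; split; first by rewrite ltW.
move=> y [/andP[y0 y1] gy].
case: n n0 g0 gy => // n _ g0 gy.
(* for n = 1 the polynomial is x^2 - x *)
case: n g0 gy => [|n] g0 gy.
  by move: g0; rewrite /bifurcation muln1 expr2 expr1 expr0; nra.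
have {}y0 : 0 < y.
  rewrite lt_def y0 andbT; apply/eqP => yz; move: gy.
  by rewrite yz mulnS addSn !expr0n /=; lra.
case: (ltgtP mu y) => // muy.
  by have := bifurcation_root_lt mu0 muy y1 g0 gy.
by have := bifurcation_root_lt y0 muy mu1 gy g0.
Qed.

End BifurcationPolynomial.

(** * Pseudo-orbits of the square billiard in cone coordinates *)

Section PseudoOrbits.
Variable R : realType.
Implicit Types (mu eps M : R) (a b : nat -> R) (s : nat -> bool).

Definition turn_step mu eps (x y x' y' : R) : Prop :=
  `|x' - (1 - mu * y)| <= eps /\ `|y' - mu * x| <= eps.

Definition jump_step mu eps (x y x' y' : R) : Prop :=
  `|x' - (1 + mu * x)| <= eps /\ `|y' - (mu * y - 1)| <= eps.

(** The choice between turn and jump is recorded by [s] and constrained only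
    through a, b >= - eps: a jump would lead to a negative b if mu * b were
    well below 1, and a turn to a negative a if mu * b were well above 1. *)
Definition pseudo_orbit mu eps a b s : Prop :=
  forall t, [/\ - eps <= a t, - eps <= b t &
    if s t then turn_step mu eps (a t) (b t) (a t.+1) (b t.+1)
    else jump_step mu eps (a t) (b t) (a t.+1) (b t.+1)].

Lemma turnP mu eps a b s t : pseudo_orbit mu eps a b s -> s t ->
  [/\ 1 - mu * b t - eps <= a t.+1, a t.+1 <= 1 - mu * b t + eps,
      mu * a t - eps <= b t.+1 & b t.+1 <= mu * a t + eps].
Proof.
move=> /(_ t)[_ _]; case: ifP => // _ [].
by rewrite !ler_norml => /andP[? ?] /andP[? ?] _; split; lra.
Qed.

Lemma jumpP mu eps a b s t : pseudo_orbit mu eps a b s -> ~~ s t ->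
  [/\ 1 + mu * a t - eps <= a t.+1, a t.+1 <= 1 + mu * a t + eps,
      mu * b t - 1 - eps <= b t.+1 & b t.+1 <= mu * b t - 1 + eps].
Proof.
move=> /(_ t)[_ _]; case: ifP => // _ [].
by rewrite !ler_norml => /andP[? ?] /andP[? ?] _; split; lra.
Qed.

(** Bounds the error accumulated along a block: mu * drift + eps <= drift, so
    that contracting steps with error eps do not increase it, and drift is at
    least the error 2 * eps of the first position after a turn. *)
Definition drift mu eps : R := 2 * eps / (1 - mu).

Definition block s u n : Prop :=
  [/\ s u, (0 < n)%N, forall k, (0 < k < n)%N -> ~~ s (u + k)%N & s (u + n)%N].

Section Fixed.
Variables (mu eps : R) (a b : nat -> R) (s : nat -> bool).
Hypothesis mu01 : 0 < mu < 1.
Hypothesis eps0 : 0 < eps.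
Hypothesis eps_small : 16 * eps <= (1 - mu) ^+ 2.
Hypothesis orb : pseudo_orbit mu eps a b s.

Lemma eps_le : 16 * eps <= 1 - mu.
Proof. have /andP[? ?] := mu01; apply: (le_trans eps_small); nra. Qed.

Let a_ge t : - eps <= a t. Proof. by case: (orb t). Qed.
Let b_ge t : - eps <= b t. Proof. by case: (orb t). Qed.

Local Notation E := (drift mu eps).

Let EP : mu * E = E - 2 * eps.
Proof. have /andP[? ?] := mu01; rewrite /drift; field; lra. Qed.

Let E_ge : 2 * eps <= E.
Proof.
have /andP[mu0 mu1] := mu01; have := mulr_gt0 mu0 eps0.
by rewrite /drift ler_pdivlMr ?subr_gt0 //; lra.
Qed.

Let eps_b t : - eps <= mu * b t.
Proof.
have /andP[mu0 mu1] := mu01; have := ler_wpM2l (ltW mu0) (b_ge t).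
have : mu * eps <= eps by rewrite ger_pMl // ltW.
by lra.
Qed.

Lemma after_turn_le u m : s u -> (forall k, (0 < k <= m)%N -> ~~ s (u + k)%N) ->
  a (u + m.+1)%N <= geosum mu m.+1 + E.
Proof.
have /andP[mu0 mu1] := mu01.
elim: m => [|m IH] su ns.
  have [_ h _ _] := turnP orb su.
  rewrite addn1 geosumS geosum0; have := eps_b u; have := E_ge; have := eps0; lra.
have nsm : ~~ s (u + m.+1)%N by apply: ns; rewrite /=.
have : a (u + m.+1)%N <= geosum mu m.+1 + E.
  by apply: IH su _ => k /andP[k0 km]; apply: ns; rewrite k0 leqW.
have [_ h _ _] := jumpP orb nsm.
rewrite -addnS in h; rewrite [geosum _ m.+2]geosumS => /(ler_wpM2l (ltW mu0)).
by have := EP; have := eps0; lra.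
Qed.

(** After n consecutive jumps following the turn that ends a block of length n,
    b would be about mu^(n+1) * geosum mu n - geosum mu n, which is at most
    mu - 1. As eps is small, this is below - eps by more than drift. *)
Lemma block_next u n : block s u n -> exists2 n', (n' <= n)%N & block s (u + n) n'.
Proof.
have /andP[mu0 mu1] := mu01.
move=> [su n0 ns sn].
have [k /andP[k0 kn] sk] : exists2 k, (0 < k <= n)%N & s (u + n + k)%N.
  apply: contrapT => H.
  have ns' k : (0 < k <= n)%N -> ~~ s (u + n + k)%N.
    by move=> hk; apply/negP => sk; apply: H; exists k => //.
  have an : a (u + n)%N <= geosum mu n + E.
    case: n n0 ns {sn H ns'} => // m _ ns; apply: (after_turn_le su).
    by move=> k /andP[k0 km]; apply: ns; rewrite k0.
  have bn i : (i <= n)%N ->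
      b (u + n + i.+1)%N <= mu ^+ i.+1 * geosum mu n - geosum mu i + E.
    elim: i => [_|i IH ni].
      have [_ _ _ h] := turnP orb sn.
      have := ler_wpM2l (ltW mu0) an; rewrite addn1 expr1 geosum0.
      by have := EP; have := eps0; lra.
    have nsi : ~~ s (u + n + i.+1)%N by apply: ns'.
    have [_ _ _ h] := jumpP orb nsi.
    have {IH} ih := IH (ltnW ni).
    rewrite [(_ + i.+2)%N]addnS [mu ^+ i.+2]exprS [geosum _ i.+1]geosumS.
    have := EP; have := eps0; have := ler_wpM2l (ltW mu0) ih; lra.
  have {bn} := bn n (leqnn n); have := b_ge (u + n + n.+1)%N.
  case: n n0 {su ns sn ns' an H} => // m _.
  have g1 : 1 <= geosum mu m.+1.
    by rewrite geosumS; have := geosum_ge0 m (ltW mu0); nra.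
  have p1 : mu ^+ m.+2 <= mu.
    rewrite exprS.
    by apply: ler_piMr (ltW mu0) (exprn_ile1 _ _ (ltW _)); rewrite ?ltW.
  have E1 : 8 * E <= 1 - mu.
    rewrite -(@ler_pM2r _ (1 - mu)); last lra.
    have -> : 8 * E * (1 - mu) = 16 * eps by rewrite /drift; field; lra.
    by move: eps_small; rewrite expr2.
  have := eps_le; have := eps0; nra.
have Hex : exists n', (0 < n')%N && s (u + n + n')%N by exists k; rewrite k0.
have [n' /andP[n'0 sn'] Hmin] := ex_minnP Hex.
exists n'; first by apply: (leq_trans (Hmin k _)) => //; rewrite k0.
split=> // i /andP[i0 in']; apply/negP => si.
by have := Hmin i; rewrite i0 si => /(_ isT); rewrite leqNgt in'.
Qed.

(** Each jump lowers b by at least one half, so a bound on b bounds the number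
    of consecutive jumps. *)
Lemma next_turn M K t : (forall t, b t <= M) -> 2 * M + 1 <= K%:R ->
  exists2 k, (k < K)%N & s (t + k)%N.
Proof.
have /andP[mu0 mu1] := mu01.
move=> bM MK; apply: contrapT => H.
have ns k : (k < K)%N -> ~~ s (t + k)%N.
  by move=> kK; apply/negP => sk; apply: H; exists k.
have bk k : (k <= K)%N -> b (t + k)%N <= M - k%:R / 2.
  elim: k => [_|k IH kK]; first by rewrite addn0 mul0r subr0.
  have [_ _ _ h] := jumpP orb (ns k kK).
  have := IH (ltnW kK); have := b_ge (t + k)%N; have := eps_le.
  rewrite addnS -natr1; nra.
have := bk K (leqnn K); have := b_ge (t + K)%N; have := eps_le; have := eps0; lra.
Qed.

(** Since the next block is never longer, a block of the minimal length that
    occurs is followed by blocks of the same length only. *)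
Lemma eventually_constant_block M K : (forall t, b t <= M) -> 2 * M + 1 <= K%:R ->
  exists u n, [/\ (0 < n <= K)%N & forall i, block s (u + i * n) n].
Proof.
move=> bM MK.
have Hex : exists n, `[< (0 < n <= K)%N /\ exists u, block s u n >].
  have [k _ sk] := next_turn 0 bM MK.
  have [k' kK' sk'] := next_turn k.+1 bM MK.
  have Hex' : exists n', (0 < n')%N && s (k + n')%N.
    by exists k'.+1; rewrite addnS -addSn.
  have [n' /andP[n'0 sn'] Hmin] := ex_minnP Hex'.
  exists n'; apply/asboolP; split.
    by rewrite n'0 /= (leq_trans (Hmin k'.+1 _)) //= addnS -addSn.
  exists k; split=> // i /andP[i0 in']; apply/negP => si.
  by have := Hmin i; rewrite i0 si => /(_ isT); rewrite leqNgt in'.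
have [n /asboolP[nK [u bu]] nmin] := ex_minnP Hex.
exists u, n; split=> //; elim=> [|i IH]; first by rewrite mul0n addn0.
have [n' n'n bn'] := block_next IH.
have nn' : (n <= n')%N.
  apply: nmin; apply/asboolP; split; last by exists (u + i * n + n)%N.
  have [_ -> _ _] := bn'; apply: (leq_trans n'n); by case/andP: nK.
have en : n' = n by apply/eqP; rewrite eqn_leq n'n.
by move: bn'; rewrite en -addnA [(i * n + n)%N]addnC -mulSn.
Qed.

Lemma blocks_periodic u n : (forall i, block s (u + i * n) n) ->
  forall k, s (u + k)%N = (n %| k)%N.
Proof.
move=> B k; have [_ n0 _ _] := B 0%N.
rewrite {1}(divn_eq k n) addnA /dvdn.
have := ltn_pmod k n0; case: (posnP (k %% n)%N) => [-> _|k0 kn].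
  by rewrite addn0; case: (B (k %/ n)%N) => ->.
have [_ _ ns _] := B (k %/ n)%N.
by apply/negbTE/ns; rewrite k0.
Qed.

Lemma block_run u n k : block s u n -> (k < n)%N ->
  [/\ mu ^+ k * a u.+1 + geosum mu k - E <= a (u.+1 + k)%N,
      a (u.+1 + k)%N <= mu ^+ k * a u.+1 + geosum mu k + E,
      mu ^+ k * b u.+1 - geosum mu k - E <= b (u.+1 + k)%N &
      b (u.+1 + k)%N <= mu ^+ k * b u.+1 - geosum mu k + E].
Proof.
have /andP[mu0 mu1] := mu01; have e0 := eps0; have Ege := E_ge; have Eeq := EP.
move=> [_ _ ns _]; elim: k => [_|k IH kn].
  by rewrite addn0 expr0 geosum0; split; lra.
have nsk : ~~ s (u.+1 + k)%N by rewrite addSnnS; apply: ns.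
have [h1 h2 h3 h4] := jumpP orb nsk.
have [/(ler_wpM2l (ltW mu0)) i1 /(ler_wpM2l (ltW mu0)) i2
      /(ler_wpM2l (ltW mu0)) i3 /(ler_wpM2l (ltW mu0)) i4] := IH (ltnW kn).
by rewrite addnS exprS geosumS; split; lra.
Qed.

Lemma block_return u n : block s u n ->
  `|a (u + n).+1 - (geosum mu n - mu ^+ n * b u.+1)| <= E /\
  `|b (u + n).+1 - (mu ^+ n * a u.+1 + geosum mu n - 1)| <= E.
Proof.
have /andP[mu0 mu1] := mu01; have e0 := eps0; have Ege := E_ge; have Eeq := EP.
move=> B; case: n B => [[]//|n] B; have [_ _ _ sn] := B.
have [/(ler_wpM2l (ltW mu0)) i1 /(ler_wpM2l (ltW mu0)) i2
      /(ler_wpM2l (ltW mu0)) i3 /(ler_wpM2l (ltW mu0)) i4] :=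
  block_run B (ltnSn n).
have [] := turnP orb sn; rewrite -addSnnS => h1 h2 h3 h4.
by rewrite exprS geosumS !ler_norml; split; apply/andP; split; lra.
Qed.

Section ConstantBlock.
Variables (gamma : R) (u n : nat).
Hypothesis gamma01 : 0 < gamma <= 1.
Hypothesis gamma_bif : gamma <= mu * `|bifurcation n mu| / 2.
Hypothesis eps_gamma : 32 * eps <= (1 - mu) ^+ 2 * gamma.
Hypothesis blocks : forall i, block s (u + i * n) n.

Local Notation L := (mu ^+ n).
Local Notation S := (geosum mu n).

(** The fixed point of the return map
    (a, b) |-> (S - L * b, L * a + S - 1) of an exact block of length n. *)
Definition fixed_a := (S - L * (S - 1)) / (1 + L ^+ 2).
Definition fixed_b := (L * S + (S - 1)) / (1 + L ^+ 2).

Let n0 : (0 < n)%N. Proof. by case: (blocks 0). Qed.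

Let L_itv : 0 < L <= mu.
Proof.
have /andP[mu0 mu1] := mu01; rewrite exprn_gt0 //=.
rewrite -(prednK n0) exprS.
by apply: ler_piMr (ltW mu0) (exprn_ile1 _ _ (ltW _)); rewrite ?ltW.
Qed.

Let S_ge1 : 1 <= S.
Proof.
have /andP[mu0 mu1] := mu01.
rewrite -(prednK n0) geosumS lerDl.
exact: mulr_ge0 (ltW mu0) (geosum_ge0 _ (ltW mu0)).
Qed.

Let fixed_eqs : fixed_a = S - L * fixed_b /\ fixed_b = L * fixed_a + S - 1.
Proof.
have /andP[L0 _] := L_itv.
by rewrite /fixed_a /fixed_b; split; field; nra.
Qed.

Let fixed_a_ge : 1 / 2 <= fixed_a.
Proof.
have /andP[L0 Lmu] := L_itv; have /andP[mu0 mu1] := mu01; have S1 := S_ge1.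
rewrite /fixed_a ler_pdivlMr; nra.
Qed.

Let fixed_a_bif :
  (1 - fixed_a) * ((1 - mu) * (1 + L ^+ 2)) = - (mu * bifurcation n mu).
Proof.
have /andP[L0 Lmu] := L_itv; have /andP[mu0 mu1] := mu01.
have -> : mu * bifurcation n mu = mu * L ^+ 2 - mu * L - L + mu.
  rewrite /bifurcation mul2n -addnn exprD expr2.
  have -> : L = mu * mu ^+ n.-1 by rewrite -exprS prednK.
  by ring.
have Sc := geosum_closed mu n.
have -> : (1 - fixed_a) * ((1 - mu) * (1 + L ^+ 2)) =
  (1 - mu) * (1 + L ^+ 2) - ((1 - mu) * S * (1 - L) + (1 - mu) * L).
  by rewrite /fixed_a; field; nra.
by rewrite Sc; ring.
Qed.

Let fixed_a_far : gamma <= `|1 - fixed_a|.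
Proof.
have /andP[L0 Lmu] := L_itv; have /andP[mu0 mu1] := mu01.
have := congr1 Num.norm fixed_a_bif; rewrite normrN normrM (normrM mu).
rewrite (gtr0_norm mu0) [X in _ * X]ger0_norm; last by nra.
have := gamma_bif; have := normr_ge0 (1 - fixed_a) => H0 H1 H2.
have : (1 - mu) * (1 + L ^+ 2) <= 2 by nra.
nra.
Qed.

Lemma return_near_fixed : exists i0, forall i, (i0 <= i)%N ->
  `|a (u + i * n).+1 - fixed_a| <= gamma / 8.
Proof.
have /andP[L0 Lmu] := L_itv; have /andP[mu0 mu1] := mu01.
(* up to sign, the return map exchanges the two deviations from the fixed point
   and multiplies them by L <= mu, so it contracts their maximum *)
pose D i := Num.max `|a (u + i * n).+1 - fixed_a| `|b (u + i * n).+1 - fixed_b|.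
have DS i : D i.+1 <= mu * D i + E.
  have [ha hb] := block_return (blocks i); have [ea eb] := fixed_eqs.
  have uS : (u + i * n + n = u + i.+1 * n)%N.
    by rewrite mulSn -addnA [(i * n + n)%N]addnC.
  rewrite uS in ha hb.
  have La x : x <= D i -> 0 <= x -> L * x <= mu * D i.
    by move=> *; apply: ler_pM => //; exact: ltW.
  have Da : L * `|b (u + i * n).+1 - fixed_b| <= mu * D i.
    by apply: La => //; rewrite le_max lexx orbT.
  have Db : L * `|a (u + i * n).+1 - fixed_a| <= mu * D i.
    by apply: La => //; rewrite le_max lexx.
  rewrite ge_max; apply/andP; split.
    rewrite ea; set x := a _ in ha *.
    have -> : x - (S - L * fixed_b) = (x - (S - L * b (u + i * n).+1))
        + - (L * (b (u + i * n).+1 - fixed_b)) by ring.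
    apply: (le_trans (ler_normD _ _)); rewrite normrN normrM (gtr0_norm L0) addrC.
    exact: lerD.
  rewrite eb; set x := b _ in hb *.
  have -> : x - (L * fixed_a + S - 1) =
      (x - (L * a (u + i * n).+1 + S - 1)) + L * (a (u + i * n).+1 - fixed_a).
    by ring.
  apply: (le_trans (ler_normD _ _)); rewrite normrM (gtr0_norm L0) addrC.
  exact: lerD.
have E0 : 0 < E by have := E_ge; have := eps0; lra.
have mu01' : 0 <= mu < 1 by rewrite ltW.
have [i0 Hi0] := contraction_eventually mu01' E0 DS.
exists i0 => i /Hi0; rewrite ge_max => /andP[h _]; apply: (le_trans h).
have -> : E / (1 - mu) + E = (2 * eps * (2 - mu)) / (1 - mu) ^+ 2.
  by rewrite /drift; field; lra.
rewrite ler_pdivrMr; last by rewrite exprn_gt0 // subr_gt0.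
by have := eps_gamma; have := eps0; nra.
Qed.

(** A jump at time t gives mu * b t >= 1 - 2 * eps, and a jump just before t gives
    a t >= 1 - 2 * eps. So only the values next to a turn matter, and these are
    controlled by the fixed point: a after a turn is near fixed_a >= 1 / 2, and
    b before it is near (1 - fixed_a) / mu. As a is at most 1 + 2 * eps after a
    turn, fixed_a cannot exceed 1 by gamma, so it is below 1 by gamma. *)
Lemma eventual_margin : exists t0, (forall k, s (t0 + k)%N = (n %| k.+1)%N) /\
  forall k, 2 * eps <= a (t0 + k)%N /\ 2 * eps <= b (t0 + k)%N.
Proof.
have /andP[mu0 mu1] := mu01; have e0 := eps0.
have /andP[g0 g1] := gamma01.
have eg : 32 * eps <= gamma.
  by apply: (le_trans eps_gamma); rewrite ger_pMl // exprn_ile1 //; lra.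
have [i0 near_fix] := return_near_fixed.
have near_fix' i : (i0 <= i)%N ->
    fixed_a - gamma / 8 <= a (u + i * n).+1 /\
    a (u + i * n).+1 <= fixed_a + gamma / 8.
  by move=> /near_fix; rewrite ler_norml => /andP[? ?]; split; lra.
have fa : fixed_a <= 1 - gamma.
  have [h _] := near_fix' i0 (leqnn _).
  have [si0 _ _ _] := blocks i0.
  have [_ h' _ _] := turnP orb si0.
  have := fixed_a_far; have := eps_b (u + i0 * n)%N.
  by case: (ger0P (1 - fixed_a)); lra.
have sper := blocks_periodic blocks.
have turn_time t : (i0 * n <= t)%N -> s (u + t)%N ->
    exists2 i, (i0 <= i)%N & t = (i * n)%N.
  move=> it; rewrite sper => /dvdnP[i ti]; exists i => //.
  by move: it; rewrite ti leq_pmul2r.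
exists (u + i0 * n).+1; split=> k.
  by rewrite addSnnS -addnA sper dvdn_addr // dvdn_mull.
split.
  rewrite addSnnS addnS -addnA.
  have [st|nst] := boolP (s (u + (i0 * n + k))%N).
    have [i i0i ->] := turn_time _ (leq_addr _ _) st.
    have [h _] := near_fix' i i0i; have := fixed_a_ge; lra.
  have [h _ _ _] := jumpP orb nst.
  have := ler_wpM2l (ltW mu0) (a_ge (u + (i0 * n + k))%N); nra.
have b_of x : 2 * eps <= mu * x -> 2 * eps <= x.
  move=> h; have x0 : 0 < x by rewrite -(pmulr_rgt0 _ mu0); lra.
  by apply: (le_trans h); rewrite ger_pMl // ltW.
apply: b_of.
rewrite addSnnS -addnA.
have [st|nst] := boolP (s (u + (i0 * n + k.+1))%N).
  have [h _ _ _] := turnP orb st; move: h.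
  have [i i0i ->] := turn_time _ (leq_addr _ _) st.
  by have [_ h'] := near_fix' i i0i; lra.
have [_ _ _ h] := jumpP orb nst.
have := b_ge (u + (i0 * n + k.+1)).+1; lra.
Qed.

End ConstantBlock.
End Fixed.

Lemma bifurcation_gap mu N : 0 < mu < 1 ->
  (forall n, (0 < n)%N -> bifurcation n mu != 0) ->
  exists2 gamma, 0 < gamma <= 1 &
    forall n, (0 < n <= N)%N -> gamma <= mu * `|bifurcation n mu| / 2.
Proof.
move=> /andP[mu0 mu1] g_neq0; elim: N => [|N [gamma /andP[g0 g1] Hg]].
  by exists 1 => [|n /andP[n0]]; rewrite ?ltr01 ?lexx // leqNgt n0.
have h0 : 0 < mu * `|bifurcation N.+1 mu| / 2.
  by rewrite divr_gt0 // mulr_gt0 // normr_gt0 g_neq0.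
exists (Num.min gamma (mu * `|bifurcation N.+1 mu| / 2)).
  by rewrite lt_min g0 h0 ge_min g1.
move=> n /andP[n0]; rewrite leq_eqVlt => /orP[/eqP->|nN].
  by rewrite ge_min lexx orbT.
by rewrite ge_min Hg ?n0.
Qed.

(** The bound M on b is what makes the number of relevant polynomials finite,
    and hence the distance gamma of their values from 0 positive. *)
Theorem pseudo_orbit_eventually_periodic mu M : 0 < mu < 1 ->
  (forall n, (0 < n)%N -> bifurcation n mu != 0) ->
  exists eps N, 0 < eps <= 1 / 16 /\
    forall a b s, pseudo_orbit mu eps a b s -> (forall t, b t <= M) ->
    exists n t0, [/\ (0 < n <= N)%N,
      forall k, s (t0 + k)%N = (n %| k.+1)%N &
      forall k, 2 * eps <= a (t0 + k)%N /\ 2 * eps <= b (t0 + k)%N].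
Proof.
move=> mu01 g_neq0; have /andP[mu0 mu1] := mu01.
pose N := Num.bound `|2 * M + 1|.
have MN : 2 * M + 1 <= N%:R.
  by apply: (le_trans (ler_norm _)); exact/ltW/archi_boundP/normr_ge0.
have [gamma g01 Hg] := bifurcation_gap N mu01 g_neq0; have /andP[g0 g1] := g01.
pose eps := (1 - mu) ^+ 2 * gamma / 32.
have p0 : 0 < (1 - mu) ^+ 2 by rewrite exprn_gt0 // subr_gt0.
have p1 : (1 - mu) ^+ 2 <= 1 by rewrite exprn_ile1 //; lra.
have e0 : 0 < eps by rewrite divr_gt0 // mulr_gt0.
have eg : 32 * eps <= (1 - mu) ^+ 2 * gamma by rewrite /eps; lra.
have es : 16 * eps <= (1 - mu) ^+ 2.
  by have : (1 - mu) ^+ 2 * gamma <= (1 - mu) ^+ 2 by [rewrite ger_pMr]; lra.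
exists eps, N; split; first by rewrite e0 /=; lra.
move=> a b s orb bM.
have [u [n [nN B]]] := eventually_constant_block mu01 e0 es orb bM MN.
have [t0 [H1 H2]] := eventual_margin mu01 e0 orb g01 (Hg n nN) eg B.
by exists n, t0.
Qed.

End PseudoOrbits.

(** * Edge functionals and cones *)

Section EdgeFunctionals.
Variables (R : realType) (k : nat) (w : 'I_k -> R[i]).
Implicit Types (a b x y z v : R[i]) (r l : R) (i j : 'I_k).

Definition edge j z : R := cross (w (ordS j) - w j) (z - w j).

Lemma crossDl a b x : cross (a + b) x = cross a x + cross b x.
Proof. by case: a b x => [? ?] [? ?] [? ?]; rewrite /cross /=; ring. Qed.

Lemma crossDr a x y : cross a (x + y) = cross a x + cross a y.
Proof. by case: a x y => [? ?] [? ?] [? ?]; rewrite /cross /=; ring. Qed.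

Lemma crossBr a x y : cross a (x - y) = cross a x - cross a y.
Proof. by case: a x y => [? ?] [? ?] [? ?]; rewrite /cross /=; ring. Qed.

Lemma crossNl a x : cross (- a) x = - cross a x.
Proof. by case: a x => [? ?] [? ?]; rewrite /cross /=; ring. Qed.

Lemma crossZr a r z : cross a (r%:C * z) = r * cross a z.
Proof. by case: a z => [? ?] [? ?]; rewrite /cross /=; ring. Qed.

Lemma edgeE j z :
  edge j z = cross (w (ordS j) - w j) z - cross (w (ordS j) - w j) (w j).
Proof. by rewrite /edge crossBr. Qed.

Lemma edge_sub j x y : edge j x - edge j y = cross (w (ordS j) - w j) (x - y).
Proof. by rewrite /edge -crossBr opprB addrA subrK. Qed.

Lemma edge_vertex j : edge j (w j) = 0.
Proof. by rewrite /edge subrr /cross /= !mulr0 subrr. Qed.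

Lemma edge_next_vertex j : edge j (w (ordS j)) = 0.
Proof. by rewrite /edge /cross mulrC subrr. Qed.

Lemma edge_reflect j l v z :
  edge j (- l%:C * z + (1 + l)%:C * v) = (1 + l) * edge j v - l * edge j z.
Proof.
rewrite /edge; move: (w (ordS j) - w j) (w j) => a u.
by case: a z v u => [? ?] [? ?] [? ?] [? ?]; rewrite /cross /=; ring.
Qed.

Lemma edge_combination j (c : 'I_k -> R) (v : 'I_k -> R[i]) :
  \sum_i c i = 1 ->
  edge j (\sum_i (c i)%:C * v i) = \sum_i c i * edge j (v i).
Proof.
move=> c1.
have -> : edge j (\sum_i (c i)%:C * v i) =
    cross (w (ordS j) - w j) (\sum_i (c i)%:C * (v i - w j)).
  rewrite /edge; congr cross.
  under [RHS]eq_bigr do rewrite mulrBr.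
  rewrite sumrB; congr (_ - _).
  by rewrite -mulr_suml -rmorph_sum c1 mul1r.
have -> : forall a, cross a (\sum_i (c i)%:C * (v i - w j)) =
    \sum_i cross a ((c i)%:C * (v i - w j)).
  move=> a; apply: (big_morph (cross a) (crossDr a)).
  by rewrite /cross /= !mulr0 subrr.
by apply: eq_bigr => i _; rewrite crossZr.
Qed.

Hypothesis ccw : ccw_convex_polygon w.

Lemma edge_polygon_ge0 j z : polygon w z -> 0 <= edge j z.
Proof.
move=> [c [c0 c1 ->]]; rewrite edge_combination //.
apply: sumr_ge0 => i _; rewrite mulr_ge0 //.
have [->|ij] := eqVneq i j; first by rewrite edge_vertex.
have [->|iSj] := eqVneq i (ordS j); first by rewrite edge_next_vertex.
by apply/ltW/ccw.2.
Qed.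

Lemma edge_lt0_table j z : edge j z < 0 -> table w z.
Proof. by move=> ez /(edge_polygon_ge0 j); rewrite leNgt ez. Qed.

Lemma val_ordS j : ordS j = (if j.+1 == k then 0 else j.+1) :> nat.
Proof.
have /= := ltn_ord j; rewrite leq_eqVlt.
by case: eqP => [e _|_ /= jk] /=; [rewrite e modnn | rewrite modn_small].
Qed.

Lemma edge_pred_vertex_gt0 j : 0 < edge j (w (ord_pred j)).
Proof.
have k2 := ccw.1; apply: ccw.2.
  rewrite -(inj_eq (@ordS_inj k)) ord_predK; apply/eqP => /(congr1 (@nat_of_ord k)).
  by rewrite val_ordS; case: ifP; lia.
rewrite -(inj_eq (@ordS_inj k)) ord_predK; apply/eqP => /(congr1 (@nat_of_ord k)).
by rewrite !val_ordS; do 2 case: ifP; lia.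
Qed.

(** Up to the positive factor D = edge j (w (ord_pred j)), edge j and
    - edge (ord_pred j) are the coordinates of z - w_j in the basis that spans
    the cone. *)
Lemma cone_edge j z : cone w j z <-> 0 < edge j z /\ edge (ord_pred j) z < 0.
Proof.
have := edge_pred_vertex_gt0 j; rewrite /cone /edge ord_predK.
case: z (w j) (w (ordS j)) (w (ord_pred j)) => [zx zy] [px py] [nx ny] [qx qy].
rewrite /cross /=; set D := (X in 0 < X) => D0.
split.
  move=> [x [y [x0 y0 [-> ->]]]].
  have xD : 0 < x * D by rewrite mulr_gt0.
  have yD : 0 < y * D by rewrite mulr_gt0.
  by rewrite /D in xD yD; split; lra.
set e := (X in 0 < X); set f := (X in X < 0) => -[e0 f0].
exists (e / D), (- f / D); split; [by rewrite divr_gt0| by rewrite divr_gt0 ?oppr_gt0|].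
have D0' := lt0r_neq0 D0.
by apply/eqP; rewrite eq_complex /=; apply/andP; split; apply/eqP;
  rewrite /e /f /D in D0' *; field.
Qed.

End EdgeFunctionals.

(** * Polygons near the square *)

Section Square.
Variable R : realType.
Implicit Types (a b x y z : R[i]) (r s M l mu : R) (j : 'I_4).

(** Balls of the sup norm rather than the modulus: reflections act on real and
    imaginary parts separately. *)
Definition box r z : Prop := `|complex.Re z| <= r /\ `|complex.Im z| <= r.

Lemma box_sub r s x y : box r x -> box s y -> box (r + s) (x - y).
Proof.
case: x y => [? ?] [? ?] [/= hx hx'] [/= hy hy'].
by split=> /=; apply: (le_trans (ler_normB _ _)); rewrite lerD.
Qed.

Lemma box_add r s x y : box r x -> box s y -> box (r + s) (x + y).
Proof.
case: x y => [? ?] [? ?] [/= hx hx'] [/= hy hy'].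
by split=> /=; apply: (le_trans (ler_normD _ _)); rewrite lerD.
Qed.

Lemma box_le r s x : r <= s -> box r x -> box s x.
Proof. by move=> rs [h1 h2]; split; [apply: le_trans h1 rs|apply: le_trans h2 rs]. Qed.

Lemma cross_box r s a b : box r a -> box s b -> `|cross a b| <= 2 * (r * s).
Proof.
case: a b => [? ?] [? ?] [/= ha ha'] [/= hb hb'].
rewrite /cross /=; apply: (le_trans (ler_normB _ _)).
by rewrite !normrM mulr2n mulrDl mul1r lerD // ler_pM.
Qed.

Lemma edge_square j z :
  edge (square R) j z =
  nth 0 [:: complex.Re z; 1 + complex.Im z; 1 - complex.Re z; - complex.Im z] j.
Proof.
by case: j => -[|[|[|[|//]]]] ?; rewrite /edge /square !(tnth_nth 0) /=;
  case: z => [? ?]; rewrite /cross /=; ring.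
Qed.

Lemma edge_square_opp j z :
  edge (square R) (ordS (ordS j)) z = 1 - edge (square R) j z.
Proof. by case: j => -[|[|[|[|//]]]] ?; rewrite !edge_square /=; ring. Qed.

Lemma edge_square_vertex j : edge (square R) (ordS j) (square R j) = 1.
Proof.
by case: j => -[|[|[|[|//]]]] ?; rewrite edge_square /square !(tnth_nth 0) /=; ring.
Qed.

Lemma edge_square_le M j z : box M z -> `|edge (square R) j z| <= 1 + M.
Proof.
move=> [h1 h2]; rewrite edge_square.
move: h1 h2; rewrite !ler_norml => /andP[? ?] /andP[? ?].
by case: j => -[|[|[|[|//]]]] ? /=; apply/andP; lra.
Qed.

Lemma square_box j : box 1 (square R j).
Proof.
by case: j => -[|[|[|[|//]]]] ?; rewrite /box /square !(tnth_nth 0) /=;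
  rewrite ?(oppr0, addr0, add0r, normr0, normrN, normr1, ler01, lexx).
Qed.

Lemma square_edge_box j : box 1 (square R (ordS j) - square R j).
Proof.
by case: j => -[|[|[|[|//]]]] ?; rewrite /box /square !(tnth_nth 0) /=;
  rewrite ?(oppr0, addr0, add0r, normr0, normrN, normr1, ler01, lexx, subrr,
            opprK, sub0r).
Qed.

Lemma ord4_cases j j' :
  [\/ j' = j, j' = ordS j, j' = ordS (ordS j) | j' = ord_pred j].
Proof.
case: j j' => -[|[|[|[|//]]]] ? [[|[|[|[|//]]]] ?];
by [constructor 1; apply/val_inj | constructor 2; apply/val_inj
   |constructor 3; apply/val_inj | constructor 4; apply/val_inj].
Qed.

Lemma ordS2_pred j : ordS (ordS j) = ord_pred (ord_pred j).
Proof. by apply/val_inj; case: j => -[|[|[|[|//]]]] ?. Qed.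

Lemma ordS2_neq j : (ordS (ordS j) == ordS j) = false.
Proof. by case: j => -[|[|[|[|//]]]] ?. Qed.

End Square.

Lemma normc_lt (R : realType) (z : R[i]) (e : R) : `|z| < e%:C ->
  `|complex.Re z| < e /\ `|complex.Im z| < e.
Proof.
move=> ze; split.
  by rewrite -ltcR; apply: le_lt_trans ze; exact: normc_ge_Re.
have -> : `|complex.Im z| = `|complex.Re (z * 'i%C)| by rewrite ReiNIm normrN.
rewrite -ltcR; apply: le_lt_trans (normc_ge_Re _) _.
by rewrite normrM [`|'i%C|]normc_def /= expr0n add0r expr1n sqrtr1 rmorph1 mulr1.
Qed.

Definition reflection (R : realType) (k : nat) (w : 'I_k -> R[i])
    (lam : 'I_k -> R) j (z : R[i]) : R[i] :=
  - (lam j)%:C * z + (1 + lam j)%:C * w j.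

Section NearSquare.
Variables (R : realType) (w : 'I_4 -> R[i]) (lam : 'I_4 -> R).
Variables (mu eps delta M : R).
Hypothesis ccw : ccw_convex_polygon w.
Hypothesis mu01 : 0 < mu < 1.
Hypothesis lam01 : forall j, 0 < lam j < 1.
Hypothesis lam_near : forall j, `|lam j - mu| <= delta.
Hypothesis w_near : forall j, box delta (w j - square R j).
Hypothesis delta1 : 0 < delta <= 1.
Hypothesis M0 : 0 <= M.
Hypothesis eps1 : eps <= 1 / 16.
(* on the box of size M, edge functionals change by at most 4 * M + 10 times the
   displacement of the vertices *)
Hypothesis delta_eps : delta * (4 * M + 10) <= eps.
Implicit Types (z : R[i]) (i j : 'I_4).

Local Notation e := (edge (square R)).
Local Notation T := (reflection w lam).

Lemma edge_near j z : box M z -> `|edge w j z - e j z| <= eps.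
Proof.
move=> zM; apply: le_trans delta_eps.
have /andP[d0 d1] := delta1.
pose d i := w i - square R i.
have -> : edge w j z - e j z = cross (d (ordS j) - d j) (z - square R j - d j)
    - cross (square R (ordS j) - square R j) (d j).
  rewrite /edge /d.
  case: z (w j) (w _) (square R j) (square R _) {zM} =>
    [? ?] [? ?] [? ?] [? ?] [? ?].
  by rewrite /cross /=; ring.
have h1 := cross_box (box_sub (w_near (ordS j)) (w_near j))
  (box_sub (box_sub zM (square_box R j)) (w_near j)).
have h2 := cross_box (square_edge_box R j) (w_near j).
apply: (le_trans (ler_normB _ _)); apply: (le_trans (lerD h1 h2)).
nra.
Qed.

Lemma edge_reflection_near i j z : box M z ->
  `|e i (T j z) - ((1 + mu) * e i (square R j) - mu * e i z)| <= eps.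
Proof.
move=> zM; have M0' := M0; apply: le_trans delta_eps; rewrite edge_reflect.
have /andP[d0 d1] := delta1; have /andP[l0 l1] := lam01 j.
have -> : (1 + lam j) * e i (w j) - lam j * e i z -
    ((1 + mu) * e i (square R j) - mu * e i z) =
    (1 + lam j) * (e i (w j) - e i (square R j))
    + (lam j - mu) * (e i (square R j) - e i z) by ring.
rewrite !edge_sub.
have h1 := cross_box (square_edge_box R i) (w_near j).
have h2 := cross_box (square_edge_box R i) (box_sub (square_box R j) zM).
apply: (le_trans (ler_normD _ _)).
rewrite !normrM (ger0_norm (_ : 0 <= 1 + lam j)); last by lra.
apply: (@le_trans _ _ (2 * (2 * (1 * delta)) + delta * (2 * (1 * (1 + M)))));
  last by nra.
apply: lerD; last exact: ler_pM.
by apply: ler_pM => //; lra.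
Qed.

(** E_j changes sign at a reflection in w_j, which excludes j' = j. On the square,
    E_(j+2) is about 1 + mu * a at the image, hence positive, which excludes the
    cone with index ord_pred j. The two other cases are the turn and the jump. *)
Lemma step_near_square j j' z : box M z -> box M (T j z) ->
  cone w j z -> cone w j' (T j z) ->
  let a := e j z in let b := - e (ord_pred j) z in
  let a' := e j' (T j z) in let b' := - e (ord_pred j') (T j z) in
  j' = ordS j /\ turn_step mu eps a b a' b' \/
  j' = ordS (ordS j) /\ jump_step mu eps a b a' b'.
Proof.
move=> zM TzM /(cone_edge ccw)[za zb] /(cone_edge ccw)[Tza Tzb] a b a' b'.
have /andP[mu0 mu1] := mu01; have /andP[l0 l1] := lam01 j; have eps1' := eps1.
have near i : `|e i (T j z) - ((1 + mu) * e i (square R j) - mu * e i z)| <= eps.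
  exact: edge_reflection_near.
have ej0 : e j (square R j) = 0 by rewrite edge_vertex.
have eS1 := edge_square_vertex R j.
have eSS1 : e (ordS (ordS j)) (square R j) = 1 by rewrite edge_square_opp ej0 subr0.
have eSz : e (ordS j) z = 1 + b.
  by rewrite /b -[in LHS](ord_predK j) edge_square_opp.
have eSSz : e (ordS (ordS j)) z = 1 - a by rewrite edge_square_opp.
have nj := near j; rewrite ej0 in nj.
have nS := near (ordS j); rewrite eS1 eSz in nS.
have nSS := near (ordS (ordS j)); rewrite eSS1 eSSz in nSS.
have a_ge : - eps <= a.
  by have := edge_near j zM; rewrite ler_norml /a => /andP[h1 h2]; lra.
have [j'E|j'E|j'E|j'E] := ord4_cases j j'; move: Tza Tzb; rewrite /a' /b' j'E.
- by rewrite edge_reflect edge_vertex => h _; exfalso; nra.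
- move=> _ _; left; split=> //; rewrite /turn_step ordSK; split.
    by move: nS; congr (`|_| <= _); ring.
  by rewrite -normrN; move: nj; congr (`|_| <= _); rewrite /a; ring.
- move=> _ _; right; split=> //; rewrite /jump_step ordSK; split.
    by move: nSS; congr (`|_| <= _); ring.
  by rewrite -normrN; move: nS; congr (`|_| <= _); ring.
rewrite -ordS2_pred => _ Tzb.
have := edge_near (ordS (ordS j)) TzM; move: nSS.
rewrite !ler_norml => /andP[h1 h2] /andP[h3 h4].
by exfalso; nra.
Qed.

Lemma cone_edge_near j z : box M z -> cone w j z ->
  - eps <= e j z /\ - eps <= - e (ord_pred j) z.
Proof.
move=> zM /(cone_edge ccw)[za zb].
have := edge_near j zM; have := edge_near (ord_pred j) zM.
by rewrite !ler_norml => /andP[? ?] /andP[? ?]; split; lra.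
Qed.

Lemma opposite_edges j z : box M z ->
  1 / 2 <= edge w j z + edge w (ordS (ordS j)) z.
Proof.
move=> zM; have := eps1; have := edge_near j zM; have := edge_near (ordS (ordS j)) zM.
by rewrite edge_square_opp !ler_norml => /andP[? ?] /andP[? ?]; lra.
Qed.

End NearSquare.

(** Adjacent cones have opposite signs of a common edge functional. On opposite
    cones both E_(j+1) and E_(j-1) would be negative, which is excluded by the
    hypothesis on their sum; on the square, this sum is 1. *)
Lemma cone_inj (R : realType) (w : 'I_4 -> R[i]) j j' z : ccw_convex_polygon w ->
  0 < edge w (ordS j) z + edge w (ord_pred j) z ->
  cone w j z -> cone w j' z -> j = j'.
Proof.
move=> ccw opp /(cone_edge ccw)[h1 h2] /(cone_edge ccw)[].
have [->|->|->|->] // := ord4_cases j j'.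
- by rewrite ordSK => ? ?; exfalso; lra.
- by rewrite ordSK => ? ?; exfalso; lra.
- by move=> ? ?; exfalso; lra.
Qed.

(** * Compositions of reflections along an itinerary *)

Section Traces.
Variables (R : realType) (k : nat) (w : 'I_k -> R[i]) (lam : 'I_k -> R).
Implicit Types (a x y p z : R[i]) (h : nat -> 'I_k) (n m q t : nat).

(** Unlike the iterates of the billiard map, this is defined for every starting
    point, and it is an affine function of it. *)
Fixpoint trace h x t : R[i] :=
  if t is t'.+1 then reflection w lam (h t') (trace h x t') else x.

Definition dilation h t : R := \prod_(i < t) (- lam (h i)).

Lemma trace_sub h x y t :
  trace h x t - trace h y t = (dilation h t)%:C * (x - y).
Proof.
elim: t => [|t IH]; first by rewrite /dilation big_ord0 mul1r.
have -> : dilation h t.+1 = - lam (h t) * dilation h t.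
  by rewrite /dilation big_ord_recr mulrC.
rewrite rmorphM /= -mulrA -IH /reflection rmorphN; ring.
Qed.

Lemma dilation_le h r t : (forall j, `|lam j| <= r) -> `|dilation h t| <= r ^+ t.
Proof.
move=> lamr; rewrite normr_prod -[t in r ^+ t]card_ord -prodr_const.
by apply: ler_prod => i _; rewrite normr_ge0 normrN lamr.
Qed.

(** The fixed point of x |-> trace h x q, an affine map with linear part
    dilation h q. *)
Definition fixpt h q : R[i] := trace h 0 q / (1 - (dilation h q)%:C).

Lemma trace_fixpt h q : `|dilation h q| < 1 -> trace h (fixpt h q) q = fixpt h q.
Proof.
move=> r1.
have r_neq : 1 - (dilation h q)%:C != 0 :> R[i].
  rewrite subr_eq0 eq_sym -(rmorph1 (real_complex R)) (inj_eq (@complexI R)).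
  by apply: contraTneq r1 => ->; rewrite normr1 ltxx.
have := trace_sub h (fixpt h q) 0 q; rewrite subr0 => /eqP.
rewrite subr_eq => /eqP ->; rewrite /fixpt.
by field.
Qed.

Lemma trace_periodic h p q : (forall t, h (t + q)%N = h t) -> trace h p q = p ->
  forall t m, trace h p (t + m * q) = trace h p t.
Proof.
move=> hq pq t; have one s : trace h p (s + q) = trace h p s.
  by elim: s => // s IH; rewrite addSn /= hq IH.
by elim=> [|m IH]; rewrite ?mul0n ?addn0 // mulSn addnCA addnC one.
Qed.

Lemma itinerary_shift h q : (forall t, h (t + q)%N = h t) ->
  forall t m, h (t + m * q)%N = h t.
Proof.
by move=> hq t; elim=> [|m IH]; rewrite ?mul0n ?addn0 // mulSn addnCA addnC hq.
Qed.

(** The traces of x and p approach each other, and the value of the affine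
    functional at the trace of p recurs with period q; so it is at least e in
    the limit. *)
Lemma trace_limit_ge h x p q r a c e : (forall j, `|lam j| <= r) -> r < 1 ->
  (0 < q)%N -> (forall t, h (t + q)%N = h t) -> trace h p q = p -> 0 < e ->
  forall t, (forall m, e <= cross a (trace h x (t + m * q)) + c) ->
  0 < cross a (trace h p t) + c.
Proof.
move=> lamr r1 q0 hq pq e0 t H.
have r0 : 0 <= r by apply: le_trans (lamr (h 0)); rewrite normr_ge0.
pose D := `|cross a (p - x)|; have D0 : 0 <= D by apply: normr_ge0.
have r01 : 0 <= r < 1 by rewrite r0.
have eD : 0 < e / 2 / (D + 1) by rewrite !divr_gt0 //; lra.
have [m0 Hm0] := geometric_small r01 eD.
rewrite -(trace_periodic hq pq t m0).
have : cross a (trace h p (t + m0 * q)) - cross a (trace h x (t + m0 * q)) =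
    dilation h (t + m0 * q) * cross a (p - x).
  by rewrite -crossBr trace_sub crossZr.
have : `|dilation h (t + m0 * q) * cross a (p - x)| <= e / 2.
  rewrite normrM -/D; have h1 := dilation_le h (t + m0 * q) lamr.
  have h2 : r ^+ (t + m0 * q) <= e / 2 / (D + 1).
    by apply: Hm0; rewrite (leq_trans (leq_pmulr m0 q0)) // leq_addl.
  have h3 : `|dilation h (t + m0 * q)| * (D + 1) <= e / 2.
    by rewrite -ler_pdivlMr; [exact: le_trans h2|lra].
  have := normr_ge0 (dilation h (t + m0 * q)); nra.
rewrite ler_norml => /andP[h1 h2]; have := H m0; lra.
Qed.

End Traces.

(** * Orbits of the billiard map *)

Section Orbits.
Variables (R : realType) (k : nat) (w : 'I_k -> R[i]) (lam : 'I_k -> R).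
Hypothesis ccw : ccw_convex_polygon w.
Local Notation T := (billiard_map w lam).
Implicit Types (x p z : R[i]) (h : nat -> 'I_k) (n m q t : nat).

Lemma cone_table j z : cone w j z -> table w z.
Proof. by move=> /(cone_edge ccw)[_ /(edge_lt0_table ccw)]. Qed.

Lemma cone_not_singular j z : cone w j z -> ~ singular_set w z.
Proof. by move=> zj [_]; apply; exists j. Qed.

Lemma billiard_map_cone z : table w z -> ~ singular_set w z ->
  exists j, cone w j z /\ T z = reflection w lam j z.
Proof.
move=> tz nz; rewrite /billiard_map; case: pickP => [j|no].
  by rewrite inE => zj; exists j.
exfalso; apply: nz; split=> // -[j _ zj]; have := no j.
by rewrite mem_set.
Qed.

Lemma reflection_table j z : 0 < lam j -> cone w j z ->
  table w (reflection w lam j z).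
Proof.
move=> l0 /(cone_edge ccw)[zj _]; apply: (@edge_lt0_table _ _ _ ccw j).
by rewrite edge_reflect edge_vertex mulr0 sub0r oppr_lt0 mulr_gt0.
Qed.

Hypothesis lam01 : forall j, 0 < lam j < 1.

Lemma nonsingular_table z n : nonsingular w lam z -> table w (iter n T z).
Proof.
move=> [tz nz]; elim: n => // n IH.
have [j [zj Tz]] := billiard_map_cone IH (nz n).
by rewrite iterS Tz; apply: reflection_table => //; case/andP: (lam01 j).
Qed.

Lemma nonsingular_itinerary z : nonsingular w lam z ->
  exists h, forall t, cone w (h t) (iter t T z) /\
    iter t.+1 T z = reflection w lam (h t) (iter t T z).
Proof.
move=> nz; suff /choice[h] : forall t, exists j, cone w j (iter t T z) /\
    iter t.+1 T z = reflection w lam j (iter t T z) by exists h.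
by move=> t; apply: billiard_map_cone (nonsingular_table nz) (nz.2 t).
Qed.

Lemma reflection_Re j z : complex.Re (reflection w lam j z) =
  - lam j * complex.Re z + (1 + lam j) * complex.Re (w j).
Proof. by rewrite /reflection; case: z (w j) => [? ?] [? ?] /=; ring. Qed.

Lemma reflection_Im j z : complex.Im (reflection w lam j z) =
  - lam j * complex.Im z + (1 + lam j) * complex.Im (w j).
Proof. by rewrite /reflection; case: z (w j) => [? ?] [? ?] /=; ring. Qed.

Lemma eventually_box r z (h : nat -> 'I_k) :
  (forall j, lam j <= r) -> r < 1 -> (forall j, box 2 (w j)) ->
  (forall t, iter t.+1 T z = reflection w lam (h t) (iter t T z)) ->
  exists t0, forall t, (t0 <= t)%N -> box (4 / (1 - r) + 1) (iter t T z).
Proof.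
move=> lamr r1 wbox zh.
have r01 : 0 <= r < 1.
  by rewrite r1 andbT; have := lamr (h 0); have := lam01 (h 0); lra.
have bnd j (x y : R) : `|y| <= 2 -> `|- lam j * x + (1 + lam j) * y| <= r * `|x| + 4.
  move=> y2; have /andP[l0 l1] := lam01 j; have lr := lamr j.
  apply: (le_trans (ler_normD _ _)); rewrite mulNr normrN !normrM.
  rewrite (gtr0_norm l0) (@gtr0_norm _ (1 + lam j)); last by lra.
  by apply: lerD; [exact: ler_wpM2r|nra].
have hRe t : `|complex.Re (iter t.+1 T z)| <= r * `|complex.Re (iter t T z)| + 4.
  have := bnd (h t) (complex.Re (iter t T z)) _ (wbox (h t)).1.
  by rewrite zh reflection_Re.
have hIm t : `|complex.Im (iter t.+1 T z)| <= r * `|complex.Im (iter t T z)| + 4.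
  have := bnd (h t) (complex.Im (iter t T z)) _ (wbox (h t)).2.
  by rewrite zh reflection_Im.
have [t1 H1] := contraction_eventually r01 ltr01 hRe.
have [t2 H2] := contraction_eventually r01 ltr01 hIm.
exists (maxn t1 t2) => t; rewrite geq_max => /andP[t1t t2t].
by split; [exact: H1|exact: H2].
Qed.

End Orbits.

(** * Itineraries with constant blocks *)

Fixpoint itinerary (n : nat) (j : 'I_4) (t : nat) : 'I_4 :=
  if t is t'.+1 then
    let i := itinerary n j t' in if (n %| t)%N then ordS i else ordS (ordS i)
  else j.

(** Each step moves by two cones, except that the t %/ n turns move by one; each
    of them thus subtracts 1, that is, adds 3 modulo 4. *)
Lemma itinerary_val n j t : (0 < n)%N ->
  itinerary n j t = ((j + 2 * t + 3 * (t %/ n)) %% 4)%N :> nat.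
Proof.
move=> n0; elim: t => [|t IH] /=.
  by rewrite muln0 div0n muln0 !addn0 modn_small.
by rewrite divnS //; case: (n %| t.+1)%N => /=; rewrite IH; lia.
Qed.

Lemma itinerary_periodic n j t : (0 < n)%N ->
  itinerary n j (t + 4 * n) = itinerary n j t.
Proof.
move=> n0; apply/val_inj; rewrite /= !itinerary_val // [(t + _)%N]addnC.
by rewrite divnMDl //; lia.
Qed.

(** * Periodic orbits and omega-limit sets *)

Section OmegaLimits.
Variables (R : realType) (k : nat) (w : 'I_k -> R[i]) (lam : 'I_k -> R).
Local Notation T := (billiard_map w lam).
Implicit Types (x p z : R[i]) (O : set R[i]).

Lemma periodic_iter p m i : iter m T p = p -> iter (i * m) T p = p.
Proof. by move=> pm; elim: i => // i IH; rewrite mulSn iterD IH. Qed.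

Lemma periodic_orbit_finite O : periodic_orbit w lam O -> finite_set O.
Proof.
move=> [p [m [_ m0 pm ->]]].
apply: (@sub_finite_set _ _ [set iter i T p | i in [set: 'I_m]]); last first.
  exact/finite_image/finite_finset.
move=> _ [t _ <-]; exists (Ordinal (ltn_pmod t m0)) => //=.
by rewrite [in RHS](divn_eq t m) addnC iterD periodic_iter.
Qed.

Lemma omega_limit_sub z O : finite_set O -> orbit_converges_to w lam z O ->
  omega_limit w lam z `<=` O.
Proof.
move=> finO zO x zx; apply: contrapT => xO.
have clO : closed (O : set (R[i] : numFieldType)).
  have /hausdorff_accessible/accessible_finite_set_closed :=
    @norm_hausdorff _ (R[i] : numFieldType).
  by apply.
have : nbhs (x : (R[i] : numFieldType)) (~` O).
  by apply: open_nbhs_nbhs; split => //; exact: closed_openC.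
move=> /nbhs_ballP[d /= d0 dO].
pose d' := complex.Re d.
have dE : d = d'%:C by rewrite /d' RRe_real // ger0_real // ltW.
have d'0 : 0 < d' by rewrite -ltcR -dE.
have d2 : 0 < d' / 2 by lra.
have dd : d = (d' / 2)%:C + (d' / 2)%:C by rewrite -rmorphD dE; congr _%:C; lra.
have A := zO _ d2.
have B : nbhs (x : (R[i] : numFieldType)) (ball (x : (R[i] : numFieldType)) (d' / 2)%:C).
  by apply: nbhsx_ballx; rewrite ltcR.
have [y [[q Oq qy]]] := zx [set y | exists2 q, O q & `|y - q| < (d' / 2)%:C] _ A B.
rewrite -ball_normE /= => xy.
apply: (dO q _ Oq); rewrite -ball_normE /= dd.
by rewrite -(subrK y x) -addrA; apply: le_lt_trans (ler_normD _ _) _; rewrite ltrD.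
Qed.

Lemma periodic_omega_limit p m : (0 < m)%N -> iter m T p = p ->
  forward_orbit w lam p `<=` omega_limit w lam p.
Proof.
move=> m0 pm x [t _ <-] A B [N _ NA] xB.
exists (iter t T p); split; last exact: (nbhs_singleton xB).
have -> : iter t T p = iter (t + N * m) T p by rewrite iterD periodic_iter.
by apply: NA => /=; rewrite (leq_trans (leq_pmulr N m0)) // leq_addl.
Qed.

Lemma forward_orbit_periodic z m t : (0 < m)%N -> iter m T z = z ->
  forward_orbit w lam (iter t T z) = forward_orbit w lam z.
Proof.
move=> m0 zm; apply/seteqP; split=> y [s _ <-].
  by exists (s + t)%N; rewrite ?iterD.
exists (s + (t * m - t))%N => //.
by rewrite -iterD -addnA subnK ?leq_pmulr // iterD periodic_iter.
Qed.

End OmegaLimits.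

(** * Limit cycles of billiards near the square *)

Section Attractor.
Variables (R : realType) (w : 'I_4 -> R[i]) (lam : 'I_4 -> R).
Variables (mu eps delta : R) (N : nat).
Hypothesis ccw : ccw_convex_polygon w.
Hypothesis mu01 : 0 < mu < 1.
Hypothesis lam01 : forall j, 0 < lam j < 1.
Hypothesis lam_near : forall j, `|lam j - mu| <= delta.
Hypothesis w_near : forall j, box delta (w j - square R j).
Hypothesis delta1 : 0 < delta <= 1.
Hypothesis delta_mu : delta <= (1 - mu) / 2.
(* a common bound of the rates below 1, and the size of a box that absorbs
   all orbits *)
Let r := (1 + mu) / 2.
Let M := 4 / (1 - r) + 1.
Hypothesis eps1 : 0 < eps <= 1 / 16.
Hypothesis delta_eps : delta * (4 * M + 10) <= eps.
Hypothesis shadowing : forall a b s, pseudo_orbit mu eps a b s ->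
  (forall t, b t <= 1 + M) ->
  exists n t0, [/\ (0 < n <= N)%N,
    forall t, s (t0 + t)%N = (n %| t.+1)%N &
    forall t, 2 * eps <= a (t0 + t)%N /\ 2 * eps <= b (t0 + t)%N].

Local Notation T := (billiard_map w lam).
Local Notation e := (edge (square R)).
Implicit Types (p x z : R[i]) (j : 'I_4).

Let r01 : 0 < r < 1.
Proof. by have := mu01; rewrite /r => /andP[? ?]; apply/andP; lra. Qed.

Let M_ge0 : 0 <= M.
Proof.
have /andP[? ?] := r01; rewrite /M addr_ge0 // divr_ge0 //; lra.
Qed.

Let lam_le j : lam j <= r.
Proof.
by have := lam_near j; have := delta_mu; rewrite ler_norml /r => ? /andP[? ?]; lra.
Qed.

Let lam_norm_le j : `|lam j| <= r.
Proof. by have /andP[l0 _] := lam01 j; rewrite gtr0_norm. Qed.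

Let box_vertex j : box 2 (w j).
Proof.
have /andP[_ d1] := delta1.
have := box_add (w_near j) (square_box R j); rewrite subrK; apply: box_le; lra.
Qed.

(** The margin 2 * eps of the coordinates given by the square leaves a margin eps
    for the edge functionals of w. *)
Lemma eventually_itinerary z : nonsingular w lam z -> exists n j t0,
  [/\ (0 < n <= N)%N,
    forall t, iter (t0 + t) T z = trace w lam (itinerary n j) (iter t0 T z) t,
    forall t, box M (iter (t0 + t) T z) &
    forall t, eps <= edge w (itinerary n j t) (iter (t0 + t) T z) /\
      edge w (ord_pred (itinerary n j t)) (iter (t0 + t) T z) <= - eps].
Proof.
move=> nz; have [h Hh] := nonsingular_itinerary ccw lam01 nz.
have /andP[r0 r1] := r01; have /andP[e0 e1] := eps1.
have [t1 bx] := eventually_box lam01 lam_le r1 box_vertex (fun t => (Hh t).2).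
pose g t := h (t1 + t)%N; pose x t := iter (t1 + t) T z.
have xM t : box M (x t) by apply: bx; rewrite leq_addr.
have xS t : x t.+1 = reflection w lam (g t) (x t).
  by rewrite /x addnS; exact: (Hh (t1 + t)%N).2.
have gx t : cone w (g t) (x t) by exact: (Hh (t1 + t)%N).1.
pose a t := e (g t) (x t); pose b t := - e (ord_pred (g t)) (x t).
pose s t := g t.+1 == ordS (g t).
have step t : g t.+1 = ordS (g t) /\ turn_step mu eps (a t) (b t) (a t.+1) (b t.+1) \/
    g t.+1 = ordS (ordS (g t)) /\ jump_step mu eps (a t) (b t) (a t.+1) (b t.+1).
  have TM := xM t.+1; have Tc := gx t.+1; rewrite xS in TM Tc.
  have := step_near_square ccw mu01 lam01 lam_near w_near delta1 M_ge0 e1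
    delta_eps (xM t) TM (gx t) Tc.
  by rewrite /a /b xS.
have orb : pseudo_orbit mu eps a b s.
  move=> t.
  have [a_ge b_ge] := cone_edge_near ccw w_near delta1 delta_eps (xM t) (gx t).
  split=> //; rewrite /s.
  by have [[-> st]|[-> st]] := step t; rewrite ?eqxx ?ordS2_neq.
have b_le t : b t <= 1 + M.
  have := edge_square_le (ord_pred (g t)) (xM t); rewrite ler_norml => /andP[h1 h2].
  by rewrite /b; lra.
have [n [t2 [nN Hs Hm]]] := shadowing orb b_le; have /andP[n0 _] := nN.
have gE t : g (t2 + t)%N = itinerary n (g t2) t.
  elim: t => [|t IH]; first by rewrite addn0.
  rewrite addnS /= -IH -Hs /s.
  by have [[-> _]|[-> _]] := step (t2 + t)%N; rewrite ?eqxx ?ordS2_neq.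
exists n, (g t2), (t1 + t2)%N; split=> //.
- elim=> [|t IH]; first by rewrite addn0.
  by rewrite addnS /= -IH -gE -addnA -xS /x addnS.
- by move=> t; rewrite -addnA; exact: xM.
move=> t; rewrite -gE -addnA -/(x _); have [ha hb] := Hm t.
have := edge_near w_near delta1 delta_eps (g (t2 + t)%N) (xM (t2 + t)%N).
have := edge_near w_near delta1 delta_eps (ord_pred (g (t2 + t)%N)) (xM (t2 + t)%N).
rewrite !ler_norml => /andP[h1 h2] /andP[h3 h4].
by rewrite /a /b in ha hb; split; lra.
Qed.

(** Four blocks of equal length lead back to the initial cone, whatever the
    length; this gives the period 4 * n of the itinerary. *)
Definition cycle_point (n : nat) j := fixpt w lam (itinerary n j) (4 * n).

Section Limit.
Variables (n : nat) (j : 'I_4) (z : R[i]) (t0 : nat).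
Hypothesis n0 : (0 < n)%N.
Local Notation h := (itinerary n j).
Local Notation p := (cycle_point n j).
Local Notation x := (iter t0 T z).
Hypothesis z_trace : forall t, iter (t0 + t) T z = trace w lam h x t.
Hypothesis z_box : forall t, box M (iter (t0 + t) T z).
Hypothesis z_margin : forall t, eps <= edge w (h t) (iter (t0 + t) T z) /\
  edge w (ord_pred (h t)) (iter (t0 + t) T z) <= - eps.

Let q0 : (0 < 4 * n)%N. Proof. by rewrite muln_gt0. Qed.

Let hq t : h (t + 4 * n)%N = h t. Proof. exact: itinerary_periodic. Qed.

Let dilation_lt1 q : (0 < q)%N -> `|dilation lam h q| < 1.
Proof.
have /andP[r0 r1] := r01; case: q => // q _.
apply: le_lt_trans (dilation_le _ _ lam_norm_le) _.
by rewrite exprn_ilt1 // ltW.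
Qed.

Let p_fix : trace w lam h p (4 * n) = p.
Proof. by apply: trace_fixpt; apply: dilation_lt1. Qed.

Let limit_gt0 a c t (e' : R) : 0 < e' ->
  (forall m, e' <= cross a (iter (t0 + (t + m * (4 * n))) T z) + c) ->
  0 < cross a (trace w lam h p t) + c.
Proof.
have /andP[_ r1] := r01 => e0 H.
apply: (trace_limit_ge (x := x) lam_norm_le r1 q0 hq p_fix e0) => m.
by rewrite -z_trace.
Qed.

Lemma limit_cone t : cone w (h t) (trace w lam h p t).
Proof.
have /andP[e0 _] := eps1.
apply/(cone_edge ccw); split.
  rewrite edgeE; apply: (@limit_gt0 _ _ t eps) => // m.
  by rewrite -edgeE -(itinerary_shift hq t m); exact: (z_margin _).1.
rewrite -oppr_gt0 edgeE opprB addrC -crossNl.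
apply: (@limit_gt0 _ _ t eps) => // m.
rewrite crossNl addrC -opprB -edgeE -(itinerary_shift hq t m).
by rewrite lerNr; exact: (z_margin _).2.
Qed.

(** The billiard map picks some cone containing the point; it is the one of the
    itinerary because the sums of opposite edge functionals are positive at the
    limit, being at least 1 / 2 along the orbit. *)
Lemma limit_map t : T (trace w lam h p t) = trace w lam h p t.+1.
Proof.
have tp := limit_cone t; have tt := cone_table ccw tp.
have [j' [tj' ->]] := billiard_map_cone lam tt (cone_not_singular tp).
rewrite /=; congr reflection; symmetry.
have /andP[_ e1] := eps1.
apply: (cone_inj ccw _ tp tj').
have -> : ord_pred (h t) = ordS (ordS (ordS (h t))) by rewrite ordS2_pred ordSK.
rewrite !edgeE addrACA -crossDl.
have half : 0 < 1 / 2 :> R by lra.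
apply: (limit_gt0 half) => m.
rewrite crossDl addrACA -!edgeE.
exact: (opposite_edges w_near delta1 e1 delta_eps).
Qed.

Lemma limit_iter t : iter t T p = trace w lam h p t.
Proof. by elim: t => // t IH; rewrite iterS IH limit_map. Qed.

Lemma limit_nonsingular : nonsingular w lam p.
Proof.
split; first exact: (cone_table ccw (limit_cone 0)).
by move=> t; rewrite limit_iter; exact: cone_not_singular (limit_cone t).
Qed.

Lemma limit_periodic : periodic_orbit w lam (forward_orbit w lam p).
Proof.
exists p, (4 * n)%N; split=> //; first exact: limit_nonsingular.
by rewrite limit_iter p_fix.
Qed.

Lemma converges_to_limit : orbit_converges_to w lam z (forward_orbit w lam p).
Proof.
have /andP[r0 r1] := r01.
move=> d d0; pose D := complex.Re `|x - p|.
have DE : `|x - p| = D%:C by rewrite /D RRe_real // normr_real.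
have D0 : 0 <= D by rewrite -lecR -DE normr_ge0.
have dD : 0 < d / (D + 1) / 2 by rewrite !divr_gt0 //; lra.
have r01' : 0 <= r < 1 by rewrite ltW.
have [k Hk] := geometric_small r01' dD.
exists (t0 + k)%N => // t /= kt.
have t0t : (t0 <= t)%N by apply: leq_trans kt; rewrite leq_addr.
exists (iter (t - t0) T p); first by exists (t - t0)%N.
rewrite -{1}(subnKC t0t) z_trace limit_iter trace_sub normrM DE.
rewrite normc_def /= expr0n addr0 sqrtr_sqr -rmorphM ltcR.
have h1 : `|dilation lam h (t - t0)| <= d / (D + 1) / 2.
  apply: (le_trans (dilation_le _ _ lam_norm_le)); apply: Hk.
  by rewrite leq_subRL.
have h2 : `|dilation lam h (t - t0)| * (D + 1) <= d / 2.
  rewrite -ler_pdivlMr; last by lra.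
  by apply: (le_trans h1); rewrite mulrAC.
have := normr_ge0 (dilation lam h (t - t0)); nra.
Qed.

(** Both points recur after m * (4 * n) steps, while their difference is multiplied
    by a factor of absolute value less than 1. *)
Lemma periodic_limit m : (0 < m)%N -> iter m T z = z -> x = p.
Proof.
move=> m0 zm.
have xm : iter (m * (4 * n)) T x = x.
  rewrite -iterD addnC iterD; congr (iter t0 T _).
  by rewrite mulnC; elim: (4 * n)%N => // i IH; rewrite mulSn iterD IH.
have := trace_sub w lam h x p (m * (4 * n)).
rewrite -z_trace addnC iterD xm -[(m * _)%N]add0n (trace_periodic hq p_fix) /=.
have := dilation_lt1 (_ : 0 < m * (4 * n))%N; rewrite muln_gt0 m0 q0 => /(_ isT) rt.
move=> /eqP; rewrite -{1}[x - p]mul1r -subr_eq0 -mulrBl mulf_eq0 => /orP[|].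
  rewrite subr_eq0 add0n -(rmorph1 (real_complex R)) (inj_eq (@complexI R)) => /eqP e1.
  by move: rt; rewrite -e1 normr1 ltxx.
by rewrite subr_eq0 => /eqP.
Qed.

End Limit.

Lemma finitely_many_periodic_orbits : finite_set (periodic_orbit w lam).
Proof.
apply: (@sub_finite_set _ _ [set forward_orbit w lam (cycle_point nj.1 nj.2) |
  nj in [set: 'I_N.+1 * 'I_4]]); last exact/finite_image/finite_finset.
move=> O [z [m [nz m0 zm ->]]].
have [n [j [t0 [/andP[n0 nN] tr bx mg]]]] := eventually_itinerary nz.
exists (inord n, j) => //=; rewrite inordK //.
by rewrite -(periodic_limit n0 tr m0 zm) (forward_orbit_periodic _ m0 zm).
Qed.

Lemma converges_to_periodic z : nonsingular w lam z ->
  exists2 O, periodic_orbit w lam O & orbit_converges_to w lam z O.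
Proof.
move=> nz; have [n [j [t0 [/andP[n0 _] tr bx mg]]]] := eventually_itinerary nz.
exists (forward_orbit w lam (cycle_point n j)).
  exact: limit_periodic n0 tr bx mg.
exact: converges_to_limit n0 tr bx mg.
Qed.

Lemma near_square_asymptotically_periodic : asymptotically_periodic w lam.
Proof.
exists (periodic_orbit w lam); split=> //.
- exact: finitely_many_periodic_orbits.
- apply/seteqP; split=> x.
    move=> [z nz zx]; have [O pO zO] := converges_to_periodic nz.
    exists O => //; exact: omega_limit_sub (periodic_orbit_finite pO) zO x zx.
  move=> [O [p [m [np m0 pm ->]]] px]; exists p => //.
  exact: (periodic_omega_limit m0 pm px).
- exact: converges_to_periodic.
Qed.

End Attractor.

(** * Asymptotic periodicity near the square *)

Theorem corollary6p2 (R : realType) (mu : R) (mu01 : 0 < mu < 1)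
    (muNLambda : ~ @Lambda R mu) :
  exists2 delta : R, 0 < delta &
    forall (w : 'I_4 -> R[i]) (lam : 'I_4 -> R),
      ccw_convex_polygon w ->
      (forall j, `|w j - square R j| < delta%:C) ->
      (forall j, 0 < lam j < 1) ->
      (forall j, `|lam j - mu| < delta) ->
      asymptotically_periodic w lam.
Proof.
have /andP[mu0 mu1] := mu01.
pose M : R := 4 / (1 - (1 + mu) / 2) + 1.
have M0 : 0 <= M by rewrite addr_ge0 // divr_ge0 //; lra.
have [eps [N [eps01 shadowing]]] := pseudo_orbit_eventually_periodic (1 + M) mu01
  (fun n => bifurcation_neq0 mu01 muNLambda).
have /andP[e0 e1] := eps01.
have D0 : 0 < 4 * M + 10 by lra.
pose d := Num.min (eps / (4 * M + 10)) (Num.min 1 ((1 - mu) / 2)).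
have d0 : 0 < d by rewrite !lt_min ltr01 !divr_gt0 //; lra.
have d1 : d <= 1 by rewrite /d !ge_min lexx !orbT.
have dmu : d <= (1 - mu) / 2 by rewrite /d !ge_min lexx !orbT.
have de : d * (4 * M + 10) <= eps by rewrite -ler_pdivlMr // /d ge_min lexx.
exists d => // w lam ccw w_near lam01 lam_near.
apply: (@near_square_asymptotically_periodic R w lam mu eps d N) => //.
- by move=> j; apply/ltW.
- by move=> j; have [h1 h2] := normc_lt (w_near j); split; apply: ltW.
- by rewrite d0.
Qed.
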